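(* Let $G$ be a finite-dimensional Lie group with identity $e$ and Lie algebra $\mathfrak{g}=T_eG$, let $\nu_u:G\to\mathfrak{g}$ be a smooth kinematic control law (in the sense defined in the context), and let $\lambda\in\mathbb{R}_{>0}$. Let $TG\simeq G\times\mathfrak{g}$ be the Lie group with the group operation $$h_1\star h_2 \triangleq \big(g_1g_2,\ \nu_1+\nu_2+\lambda\nu_u(g_1)+\lambda\nu_u(g_2)-\lambda\nu_u(g_1g_2)\big),\qquad h_i=(g_i,\nu_i)\in TG.$$ Define $$H\triangleq\{h=(g,\nu)\in TG\mid s(h)=0\}\subset TG,$$ where the map $s:TG\to\mathfrak{g}$ is defined by $s(h)=\nu+\lambda\nu_u(g)$ for all $h=(g,\nu)\in TG$. Then $H\subset TG$ is a Lie subgroup under the group operation $\star$.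
   Context: The tangent bundle $TG$ is identified with $G\times\mathfrak{g}$ by left translation: $(g,\nu)$ corresponds to the tangent vector $g\cdot\nu\triangleq T_eL_g(\nu)\in T_gG$, where $L_g(h)=gh$. Under $\star$ the identity of $TG$ is $f=(e,0)$ and the inverse of $(g,\nu)$ is $(g^{-1},-\nu)$. Let $V:G\to\mathbb{R}_{\ge 0}$ be an infinitely differentiable proper Morse function satisfying $V(g)>0$ for all $g\in G\setminus\{e\}$, and $\mathrm{d}V(g)=0$ and $V(g)=0\iff g=e$. Kinematic control law: a map $\nu_u:G\to\mathfrak{g}$ is a kinematic control law (relative to $V$) if, for the kinematics $\dot g(t)=g(t)\cdot\nu(t)$: (i) $\nu_u(e)=0$; (ii) $\nu_u(g^{-1})=-\nu_u(g)$ for all $g\in G$; (iii) $\langle \mathrm{d}V(g);\,-g\cdot\nu_u(g)\rangle<0$ for all $g\in G\setminus(\mathcal{O}_u\cup\{e\})$, where $\mathcal{O}_u\triangleq\{g\in G\setminus\{e\}\mid g\cdot\nu_u(g)=0\}$; (iv) $\langle \mathrm{d}V(g);\,-g\cdot\nu_u(g)\rangle=-y(g)V(g)$ for all $g\in\mathcal{U}$, where $y:\mathcal{U}\to\mathbb{R}_{>0}$ and $\mathcal{U}\subset G\setminus\mathcal{O}_u$ is a neighborhood of $e$. Here $\langle\cdot;\cdot\rangle$ denotes the pairing of a covector with a vector. *)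

(* Defs.v *)
From HB Require Import structures.
From mathcomp Require Import all_boot all_order all_algebra.
From mathcomp Require Import all_classical all_reals all_analysis.

Set Implicit Arguments.
Unset Strict Implicit.
Unset Printing Implicit Defensive.

Import Order.TTheory GRing.Theory Num.Theory numFieldNormedType.Exports.
Local Open Scope classical_set_scope.
Local Open Scope ring_scope.

Section SmoothFunctions.
Context {R : realType} {n : nat} {W : normedModType R}.

(* Meant for open U, so that the operators below only see f near points of U:
   what f does off U is irrelevant. *)
Fixpoint Ck_on (k : nat) (U : set 'rV[R]_n) (f : 'rV[R]_n -> W) : Prop :=
  match k with
  | 0 => forall x, U x -> {for x, continuous f}
  | k'.+1 => (forall x, U x -> differentiable f x) /\
             (forall v, Ck_on k' U (fun x => 'D_v f x))
  end.

Definition smooth_on (U : set 'rV[R]_n) (f : 'rV[R]_n -> W) : Prop :=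
  forall k, Ck_on k U f.

End SmoothFunctions.

(* The map and its inverse are total functions, meaningful only on [cdom] and on
   the image of [cdom] respectively. *)
Record chart (R : realType) (T : topologicalType) (n : nat) := Chart {
  cdom : set T;
  cmap :> T -> 'rV[R]_n;
  cinv : 'rV[R]_n -> T }.

Section Manifolds.
Context {R : realType}.

Definition cimg {T : topologicalType} {n} (c : chart R T n) : set 'rV[R]_n :=
  cmap c @` cdom c.

Record is_chart {T : topologicalType} {n} (c : chart R T n) : Prop := IsChart {
  chart_dom_open : open (cdom c);
  chart_img_open : open (cimg c);
  chart_cancel : {in cdom c, cancel c (cinv c)};
  chart_cont : forall p, cdom c p -> {for p, continuous (cmap c)};
  chart_inv_cont : forall x, cimg c x -> {for x, continuous (cinv c)} }.

(* A smooth structure is given by any atlas, not necessarily a maximal one. *)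
Record manifold {T : topologicalType} {n} (A : set (chart R T n)) : Prop :=
  Manifold {
  mfd_hausdorff : hausdorff_space T;
  mfd_second_countable : @second_countable T;
  mfd_chart : forall c, A c -> is_chart c;
  mfd_cover : forall p, exists2 c, A c & cdom c p;
  mfd_compat : forall c d, A c -> A d ->
    smooth_on (cmap c @` (cdom c `&` cdom d)) (d \o cinv c) }.

Definition smooth_map {T S : topologicalType} {n m}
    (A : set (chart R T n)) (B : set (chart R S m)) (f : T -> S) : Prop :=
  continuous f /\
  forall c d, A c -> B d ->
    smooth_on (cmap c @` (cdom c `&` f @^-1` cdom d)) (d \o f \o cinv c).

Definition smooth_fun {T : topologicalType} {n}
    (A : set (chart R T n)) (V : T -> R) : Prop :=
  forall c, A c -> smooth_on (cimg c) (V \o cinv c).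

Definition prod_chart {T S : topologicalType} {n m}
    (c : chart R T n) (d : chart R S m) : chart R (T * S)%type (n + m) :=
  {| cdom := cdom c `*` cdom d;
     cmap := fun x => row_mx (c x.1) (d x.2);
     cinv := fun z => (cinv c (lsubmx z), cinv d (rsubmx z)) |}.

Definition prod_atlas {T S : topologicalType} {n m}
    (A : set (chart R T n)) (B : set (chart R S m)) :
    set (chart R (T * S)%type (n + m)) :=
  [set prod_chart c d | c in A & d in B].

End Manifolds.

Section TangentSpaces.
Context {R : realType} {T : topologicalType} {n : nat}.
Variables (A : set (chart R T n)) (p : T).

Definition charts_at : set (chart R T n) := [set c | A c /\ cdom c p].

(* A tangent vector at p is the family of its coordinates in all the charts of
   the atlas around p, the coordinates in two charts being related by the
   differential of the transition map. *)
Definition tangent_pred : {pred charts_at -> 'rV[R]_n} :=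
  fun v => `[< forall c d : charts_at,
     v d = 'd (cmap (val d) \o cinv (val c)) (cmap (val c) p) (v c) >].

Lemma tangent_submod : submod_closed tangent_pred.
Proof.
split=> [|a u v]; first by apply/asboolP => c d; rewrite linear0.
move=> /asboolP hu /asboolP hv; apply/asboolP => c d.
have E (x : charts_at) : (a *: u + v) x = a *: u x + v x by [].
by rewrite !E linearP -hu -hv.
Qed.

HB.instance Definition _ :=
  GRing.isSubmodClosed.Build R (charts_at -> 'rV[R]_n) tangent_pred
    tangent_submod.

Record tangent := Tangent {
  tcoord :> charts_at -> 'rV[R]_n;
  tangentP : tcoord \in tangent_pred }.

HB.instance Definition _ := [isSub for tcoord].
HB.instance Definition _ := [Choice of tangent by <:].
HB.instance Definition _ := [SubChoice_isSubLmodule of tangent by <:].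

(* The vector-space topology, all coordinates being linear isomorphisms. *)
HB.instance Definition _ := Topological.copy tangent
  (initial_topology
    (tcoord : tangent -> prod_topology (fun _ : charts_at => 'rV[R]_n))).

End TangentSpaces.
Arguments charts_at {R T n} A p _.

Section Calculus.
Context {R : realType}.

(* T_pM as a manifold: the charts are the global linear coordinate maps. *)
Definition tangent_atlas {T : topologicalType} {n} (A : set (chart R T n))
    (p : T) : set (chart R (tangent A p) n) :=
  [set k | [/\ cdom k = setT,
               exists c : charts_at A p, cmap k = (fun v : tangent A p => v c),
               cancel k (cinv k) & cancel (cinv k) k]].

(* The differential at p of a smooth f with f p = q, applied to v.  The point q
   is a separate argument so that, e.g., the image of T_eG under the left
   translation by g can be typed as T_gG rather than T_(ge)G. *)
Definition tmap {T S : topologicalType} {n m}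
    (A : set (chart R T n)) (B : set (chart R S m)) (f : T -> S)
    (p : T) (q : S) (v : tangent A p) : tangent B q :=
  xget 0 [set w : tangent B q | f p = q /\
    forall (c : charts_at A p) (d : charts_at B q),
      w d = 'd (cmap (val d) \o f \o cinv (val c)) (cmap (val c) p) (v c)].

(* <dV(p); w> *)
Definition dpair {T : topologicalType} {n} (A : set (chart R T n))
    (V : T -> R) (p : T) (w : tangent A p) : R :=
  xget 0 [set r : R | forall c : charts_at A p,
    r = 'd (V \o cinv (val c)) (cmap (val c) p) (w c)].

Definition critical_point {T : topologicalType} {n} (A : set (chart R T n))
    (V : T -> R) (p : T) : Prop :=
  forall w : tangent A p, dpair V w = 0.

Definition hessian {n} (f : 'rV[R]_n -> R) (x : 'rV[R]_n) : 'M[R]_n :=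
  \matrix_(i, j)
    'D_(delta_mx 0 i : 'rV[R]_n) (fun y => 'D_(delta_mx 0 j : 'rV[R]_n) f y) x.

Definition morse {T : topologicalType} {n} (A : set (chart R T n))
    (V : T -> R) : Prop :=
  smooth_fun A V /\
  forall p, critical_point A V p ->
    forall c, charts_at A p c -> hessian (V \o cinv c) (c p) \in unitmx.

(* For V >= 0 this is properness as a map into [0, +oo[. *)
Definition proper_fun {T : topologicalType} (V : T -> R) : Prop :=
  forall K : set R, compact K -> compact (V @^-1` K).

End Calculus.
Arguments tangent_atlas {R T n} A p _.

Section LieGroups.
Context {R : realType}.

Record group_laws {T : Type} (mul : T -> T -> T) (one : T) (inv : T -> T) : Prop
  := GroupLaws {
  grp_assoc : associative mul;
  grp_left_id : left_id one mul;
  grp_right_id : right_id one mul;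
  grp_left_inv : left_inverse one inv mul;
  grp_right_inv : right_inverse one inv mul }.

Record lie_group {T : topologicalType} {n} (A : set (chart R T n))
    (mul : T -> T -> T) (one : T) (inv : T -> T) : Prop := LieGroup {
  lie_manifold : manifold A;
  lie_group_laws : group_laws mul one inv;
  lie_mul_smooth : smooth_map (prod_atlas A A) A (fun x => mul x.1 x.2);
  lie_inv_smooth : smooth_map A A inv }.

Definition immersion {T S : topologicalType} {n m}
    (A : set (chart R T n)) (B : set (chart R S m)) (f : T -> S) : Prop :=
  smooth_map A B f /\
  forall p, injective (@tmap R T S n m A B f p (f p)).

Record subgroup_set {T : Type} (mul : T -> T -> T) (one : T) (inv : T -> T)
    (H : set T) : Prop := SubgroupSet {
  subgrp_one : H one;
  subgrp_mul : forall x y, H x -> H y -> H (mul x y);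
  subgrp_inv : forall x, H x -> H (inv x) }.

(* H is a Lie subgroup of the Lie group T when it is a subgroup carrying a Lie
   group structure (its own topology and atlas) for which the inclusion is an
   immersion.  The set H with that structure is presented as the image of an
   injective homomorphism i from a Lie group S.  Second countability, part of
   [manifold], excludes the discrete topology on an uncountable H. *)
Record lie_subgroup {T : topologicalType} {n} (A : set (chart R T n))
    (mul : T -> T -> T) (one : T) (inv : T -> T) (H : set T) : Prop :=
  LieSubgroup {
  liesub_ambient : lie_group A mul one inv;
  liesub_subgroup : subgroup_set mul one inv H;
  liesub_structure :
    exists (S : topologicalType) (m : nat) (B : set (chart R S m))
           (mulS : S -> S -> S) (oneS : S) (invS : S -> S) (i : S -> T),
      [/\ lie_group B mulS oneS invS,
          immersion B A i,
          injective i,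
          range i = H &
          {morph i : x y / mulS x y >-> mul x y}] }.

End LieGroups.

Section Control.
Context {R : realType} {G : topologicalType} {n : nat}.
Variables (A : set (chart R G n)).
Variables (mul : G -> G -> G) (one : G) (inv : G -> G).

(* g . nu = T_e L_g (nu) *)
Definition ltrans (g : G) (nu : tangent A one) : tangent A g :=
  tmap A (mul g) g nu.

(* V : G -> R stands for a map into the nonnegative reals, by [pot_ge0]. *)
Record potential (V : G -> R) : Prop := Potential {
  pot_ge0 : forall g, 0 <= V g;
  pot_proper : proper_fun V;
  pot_morse : morse A V;
  pot_gt0 : forall g, g <> one -> 0 < V g;
  pot_zero : forall g, (critical_point A V g /\ V g = 0) <-> g = one }.

Definition zero_set (nu_u : G -> tangent A one) : set G :=
  [set g | g <> one /\ ltrans g (nu_u g) = 0].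

Record kinematic_control_law (V : G -> R) (nu_u : G -> tangent A one) : Prop :=
  KinematicControlLaw {
  kcl_one : nu_u one = 0;
  kcl_inv : forall g, nu_u (inv g) = - nu_u g;
  kcl_descent : forall g, ~ (zero_set nu_u `|` [set one]) g ->
    dpair V (- ltrans g (nu_u g)) < 0;
  kcl_rate : exists (U : set G) (y : G -> R),
    [/\ nbhs one U, U `<=` ~` zero_set nu_u,
        forall g, U g -> 0 < y g &
        forall g, U g -> dpair V (- ltrans g (nu_u g)) = - y g * V g] }.

(* TG in the left trivialization, as a product manifold. *)
Definition TG : topologicalType := (G * tangent A one)%type.

Definition TG_atlas : set (chart R TG (n + n)) :=
  prod_atlas A (tangent_atlas A one).

Variables (lambda : R) (nu_u : G -> tangent A one).

Definition star (h1 h2 : TG) : TG :=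
  (mul h1.1 h2.1,
   h1.2 + h2.2 + lambda *: nu_u h1.1 + lambda *: nu_u h2.1
     - lambda *: nu_u (mul h1.1 h2.1)).

Definition star_one : TG := (one, 0).

Definition star_inv (h : TG) : TG := (inv h.1, - h.2).

Definition sliding_var (h : TG) : tangent A one := h.2 + lambda *: nu_u h.1.

Definition sliding_set : set TG := [set h | sliding_var h = 0].

End Control.
Arguments TG_atlas {R G n} A one _.
Arguments star_one {R G n} A one.

(* Main.v *)
Require Import Defs.
From HB Require Import structures.
From mathcomp Require Import all_boot all_order all_algebra.
From mathcomp Require Import all_classical all_reals all_analysis.

Set Implicit Arguments.
Unset Strict Implicit.
Unset Printing Implicit Defensive.

Import Order.TTheory GRing.Theory Num.Theory numFieldNormedType.Exports.
Local Open Scope classical_set_scope.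
Local Open Scope ring_scope.

(** Write [s] for the sliding variable.  A direct computation gives
    [s (h * k) = s h + s k] for the operation [star], so the shear
    [h |-> (h.1, s h)] carries [star] to the direct product of [G] with the
    additive group of its Lie algebra.  Since the shear is injective, an
    equation in [TG] can be checked on the two components [h.1] and [s h],
    where it is an equation in [G] or an additive one; this yields the group
    axioms, and it shows that the zero set of [s] is a subgroup.

    This zero set is the graph of [g |-> - lambda nu_u g].  It receives the
    structure of a Lie group from [G], through the section
    [g |-> (g, - lambda nu_u g)] of the first projection.  The section is a
    homomorphism because both sides of the homomorphism equation have the same
    first component and [s = 0]; it is an immersion because the projection is
    a smooth left inverse ([section_immersion], by the chain rule).

    The equation [nu_u e = 0] gives the unit, [nu_u (g^-1) = - nu_u g] the
    inverse, and the smoothness of [nu_u] that of the operations.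

    What remains is that [TG] is a manifold and that maps assembled from
    products, projections, multiplication and linear operations on the Lie
    algebra are smooth.  The main steps are the closure of [Ck_on] under
    composition ([Ck_on_comp]), the stability of smooth maps under composition
    and pairing ([smooth_map_comp], [smooth_map_pair], [manifold_prod]), and
    the fact that each chart at [p] gives a global linear homeomorphism of the
    tangent space at [p] onto the coordinate space, which makes the tangent
    space a manifold ([manifold_tangent]). *)

(** * Differentials of functions that agree near a point *)
Section NearEq.
Context {R : numFieldType} {V W : normedModType R}.

Lemma near_eq_differentiable (f g : V -> W) x :
  {near x, f =1 g} -> differentiable f x -> differentiable g x.
Proof.
move=> fg df; have gfx : g x = f x by rewrite (nbhs_singleton fg).
have [cdf /eqaddoP fE] := (diff_locallyP x f).1 df.
have gE : g \o shift x = cst (g x) + 'd f x +o_ 0 id.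
  apply/eqaddoP => eps eps0; have := fE _ eps0; apply: filter_app.
  have : \forall h \near (0 : V), f (h + x) = g (h + x).
    by rewrite (near_shift x (0 : V)) /= sub0r; near do rewrite /= subrK.
  by apply: filterS => h fgh; rewrite !fctE /= gfx -fgh.
by apply/diff_locallyP; rewrite (diff_unique cdf gE).
Unshelve. all: by end_near. Qed.

Lemma near_eq_diff (f g : V -> W) x v :
  {near x, f =1 g} -> differentiable f x -> 'd f x v = 'd g x v.
Proof.
move=> fg df; rewrite -!deriveE //; first exact: near_eq_derive.
exact: near_eq_differentiable df.
Qed.

End NearEq.

(** * Linear maps and scaling *)
Lemma linear_rV_continuous {R : numFieldType} {n} {W : normedModType R}
  (f : {linear 'rV[R]_n -> W}) : continuous f.
Proof.
have -> : (f : _ -> _) =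
    fun v => \sum_(i < n) v 0 i *: f (delta_mx 0 i : 'rV[R]_n).
  apply/funext => v; rewrite {1}(row_sum_delta v) linear_sum.
  by apply: eq_bigr => i _; rewrite linearZ.
apply: continuous_big => [|i _].
  by move=> z; exact: add_continuous.
by move=> v; apply: continuousZr_tmp; exact: coord_continuous.
Qed.

Section Scale.
Context {R : realType} {V W : normedModType R}.

Lemma scale_is_bilinear :
  bilinear_for (GRing.Scale.Law.clone _ _ *:%R _)
    (GRing.Scale.Law.clone _ _ *:%R _) ( *:%R : R -> W -> W).
Proof.
split=> [w|r] a x y /=; first by rewrite scalerDl scalerA.
by rewrite scalerDr !scalerA mulrC.
Qed.

HB.instance Definition _ := bilinear_isBilinear.Build R R W W _ _
  ( *:%R : R -> W -> W) scale_is_bilinear.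

(** The Leibniz rule: scaling is a continuous bilinear map. *)
Lemma is_diff_scale (p : V -> R) (q : V -> W) (dp : V -> R) (dq : V -> W) x :
  is_diff x p dp -> is_diff x q dq ->
  is_diff x (fun y => p y *: q y) (fun v => p x *: dq v + dp v *: q x).
Proof.
move=> hp hq; pose S (z : R * W) := z.1 *: z.2.
have cS : continuous S by exact: scale_continuous.
have dS z : is_diff z S (fun w => z.1 *: w.2 + w.1 *: z.2).
  by apply: DiffDef; [exact: (differentiable_bilin z cS)|exact: (diff_bilin z cS)].
exact: (@is_diff_comp _ _ _ _ (fun y => (p y, q y)) _ S).
Qed.

End Scale.

(** * Calculus of functions of class C^k *)
Section SmoothCalculus.
Context {R : realType}.
Implicit Types W : normedModType R.

(** The derivatives in [Ck_on] are those of the total function, whatever the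
    set, so being of class C^k on a set is a condition at each of its points.
    This is what makes smoothness a local property. *)
Lemma Ck_on_pointwise {n W} k (U : set 'rV[R]_n) (f : 'rV[R]_n -> W) :
  (forall x, U x -> exists2 V : set 'rV[R]_n, V x & Ck_on k V f) ->
  Ck_on k U f.
Proof.
elim: k f => [|k IH] f h /=; first by move=> x /h[V Vx /(_ x Vx)].
split=> [x /h[V Vx [dV _]]|v]; first exact: dV.
by apply: IH => x /h[V Vx [_ dV]]; exists V => //; exact: dV.
Qed.

Lemma Ck_on_subset {n W} k (U V : set 'rV[R]_n) (f : 'rV[R]_n -> W) :
  U `<=` V -> Ck_on k V f -> Ck_on k U f.
Proof. by move=> UV fV; apply: Ck_on_pointwise => x /UV Vx; exists V. Qed.

(** Openness makes the equality hold near each point, hence for all the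
    derivatives as well. *)
Lemma Ck_on_eq {n W} k (U : set 'rV[R]_n) (f g : 'rV[R]_n -> W) :
  open U -> {in U, f =1 g} -> Ck_on k U f -> Ck_on k U g.
Proof.
move=> oU; elim: k f g => [|k IH] f g fg.
  move=> fC x Ux; have fgx : {near x, f =1 g}.
    by near=> y; apply: fg; rewrite inE; near: y; exact: open_nbhs_nbhs.
  apply: cvg_trans (near_eq_cvg fgx) _.
  have fCx : f @ x --> f x := fC x Ux.
  by rewrite (nbhs_singleton fgx) in fCx.
have nfg x : U x -> {near x, f =1 g}.
  move=> Ux; near=> y; apply: fg; rewrite inE; near: y; exact: open_nbhs_nbhs.
move=> [fd fC]; split=> [x Ux|v].
  by apply: near_eq_differentiable (fd x Ux); exact: nfg.
apply: IH (fC v) => x; rewrite inE => Ux; apply: near_eq_derive; exact: nfg.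
Unshelve. all: by end_near. Qed.

Lemma Ck_onS {n W} k (U : set 'rV[R]_n) (f : 'rV[R]_n -> W) :
  Ck_on k.+1 U f -> Ck_on k U f.
Proof.
elim: k f => [|k IH] f [fd fC]; last by split=> // v; exact: IH.
by move=> x Ux; apply: differentiable_continuous; exact: fd.
Qed.

Lemma Ck_on_cst {n W} k (U : set 'rV[R]_n) (w : W) : Ck_on k U (cst w).
Proof.
elim: k w => [|k IH] w /=; first by move=> x _; exact: cst_continuous.
split=> [x _|v]; first exact: differentiable_cst.
have -> : (fun x => 'D_v (cst w) x) = cst (0 : W); last exact: IH.
by apply/funext => x; rewrite derive_cst.
Qed.

Lemma Ck_on_linear {n W} k (U : set 'rV[R]_n) (L : {linear 'rV[R]_n -> W}) :
  Ck_on k U L.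
Proof.
case: k => [|k] /=; first by move=> x _; exact: linear_rV_continuous.
have dL x : differentiable L x.
  exact/linear_differentiable/linear_rV_continuous.
split=> // v; have -> : (fun x => 'D_v L x) = cst (L v); last exact: Ck_on_cst.
by apply/funext => x; rewrite deriveE // diff_lin //; exact: linear_rV_continuous.
Qed.

Lemma Ck_onD {n W} k (U : set 'rV[R]_n) (f g : 'rV[R]_n -> W) :
  open U -> Ck_on k U f -> Ck_on k U g -> Ck_on k U (fun x => f x + g x).
Proof.
move=> oU; elim: k f g => [|k IH] f g.
  by move=> fC gC x Ux; apply: continuousD; [exact: fC|exact: gC].
move=> [fd fC] [gd gC]; split=> [x Ux|v].
  by apply: differentiableD; [exact: fd|exact: gd].
apply: Ck_on_eq (IH _ _ (fC v) (gC v)) => // x; rewrite inE => Ux.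
by rewrite deriveD //; apply: diff_derivable; [exact: fd|exact: gd].
Qed.

Lemma Ck_on_sum {n W} k (U : set 'rV[R]_n) m (f : 'I_m -> 'rV[R]_n -> W) :
  open U -> (forall i, Ck_on k U (f i)) ->
  Ck_on k U (fun x => \sum_(i < m) f i x).
Proof.
move=> oU; elim: m f => [|m IH] f fC.
  have -> : (fun x => \sum_(i < 0) f i x) = cst 0; last exact: Ck_on_cst.
  by apply/funext => x; rewrite big_ord0.
have -> : (fun x => \sum_(i < m.+1) f i x) =
    (fun x => f ord0 x + \sum_(i < m) f (lift ord0 i) x).
  by apply/funext => x; rewrite big_ord_recl.
by apply: Ck_onD => //; exact: IH.
Qed.

Lemma Ck_on_linear_comp {n W W'} k (U : set 'rV[R]_n) (L : {linear W -> W'})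
    (f : 'rV[R]_n -> W) :
  open U -> continuous L -> Ck_on k U f -> Ck_on k U (L \o f).
Proof.
move=> oU cL; elim: k f => [|k IH] f.
  by move=> fC x Ux; apply: continuous_comp; [exact: fC|exact: cL].
move=> [fd fC]; have dL w : differentiable L w by exact: linear_differentiable.
split=> [x Ux|v]; first by apply: differentiable_comp => //; exact: fd.
apply: Ck_on_eq (IH _ (fC v)) => // x; rewrite inE => Ux.
have dfx := fd x Ux.
have dLf := differentiable_comp dfx (dL (f x)).
rewrite [RHS](deriveE v dLf) (diff_comp dfx (dL _)) /=.
by rewrite (diff_lin _ cL) deriveE.
Qed.

Lemma Ck_on_scale {n W} k (U : set 'rV[R]_n) (p : 'rV[R]_n -> R)
    (f : 'rV[R]_n -> W) :
  open U -> Ck_on k U p -> Ck_on k U f -> Ck_on k U (fun x => p x *: f x).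
Proof.
move=> oU; elim: k p f => [|k IH] p f.
  by move=> pC fC x Ux; apply: continuousZ; [exact: pC|exact: fC].
move=> pC1 fC1; have [pC0 fC0] := (Ck_onS pC1, Ck_onS fC1).
case: pC1 fC1 => [pd pC] [fd fC].
have d x : U x -> is_diff x (fun y => p y *: f y)
    (fun v => p x *: 'd f x v + 'd p x v *: f x).
  by move=> Ux; apply: is_diff_scale; apply: differentiableP; [exact: pd|exact: fd].
split=> [x Ux|v]; first by have [] := d x Ux.
apply: Ck_on_eq (Ck_onD oU (IH _ _ pC0 (fC v)) (IH _ _ (pC v) fC0)) => //.
move=> x; rewrite inE => Ux; have [dpf dE] := d x Ux.
by rewrite [RHS]deriveE // dE !deriveE //; [exact: pd|exact: fd].
Qed.

Definition row_coord {m} (j : 'I_m) (w : 'rV[R]_m) : R := w 0 j.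

Lemma row_coord_linear {m} (j : 'I_m) : linear (row_coord j).
Proof. by move=> a u v; rewrite /row_coord !mxE. Qed.

HB.instance Definition _ m (j : 'I_m) :=
  GRing.isLinear.Build R 'rV[R]_m R _ (row_coord j) (row_coord_linear j).

(** In coordinates the chain rule reads
    [D_v (g o f) = \sum_j (D_v f)_j * (D_(e_j) g o f)]; each factor is of class
    C^k by the induction hypothesis, and sums and products preserve the class. *)
Lemma Ck_on_comp {n m W} k (U : set 'rV[R]_n) (V : set 'rV[R]_m)
    (f : 'rV[R]_n -> 'rV[R]_m) (g : 'rV[R]_m -> W) :
  open U -> U `<=` f @^-1` V ->
  Ck_on k U f -> Ck_on k V g -> Ck_on k U (g \o f).
Proof.
move=> oU fUV; elim: k f g fUV => [|k IH] f g fUV.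
  by move=> fC gC x Ux; apply: continuous_comp; [exact: fC|exact/gC/fUV].
move=> fC1; have fC0 := Ck_onS fC1.
case: fC1 => [fd fC] [gd gC]; split=> [x Ux|v].
  by apply: differentiable_comp; [exact: fd|exact/gd/fUV].
pose h x := \sum_(j < m)
  'D_v f x 0 j *: 'D_(delta_mx 0 j : 'rV[R]_m) g (f x).
have hC : Ck_on k U h.
  apply: Ck_on_sum => // j; apply: Ck_on_scale => //; last exact: IH (gC _).
  exact: (Ck_on_linear_comp oU (@linear_rV_continuous _ _ _ (row_coord j)) (fC v)).
apply: Ck_on_eq hC => // x; rewrite inE => Ux.
have [dfx dgx] := (fd x Ux, gd _ (fUV x Ux)).
rewrite [RHS]deriveE; last exact: differentiable_comp.
rewrite (diff_comp dfx dgx) /= -(deriveE v dfx).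
rewrite [in RHS](row_sum_delta ('D_v f x)) linear_sum.
by apply: eq_bigr => j _; rewrite linearZ /= -deriveE.
Qed.

End SmoothCalculus.

(** * Products of topological spaces *)
Section ProductTopology.
Context {T S : topologicalType}.

Lemma open_setX (U : set T) (V : set S) : open U -> open V -> open (U `*` V).
Proof.
move=> oU oV; rewrite openE => -[x y] [/= Ux Vy].
by exists (U, V) => //; split; exact: open_nbhs_nbhs.
Qed.

Lemma fst_continuous : continuous (@fst T S).
Proof. by move=> p; exact: cvg_fst. Qed.

Lemma snd_continuous : continuous (@snd T S).
Proof. by move=> p; exact: cvg_snd. Qed.

Lemma pair_continuous_at {X : topologicalType} (f : X -> T) (g : X -> S) x :
  {for x, continuous f} -> {for x, continuous g} ->
  {for x, continuous (fun y => (f y, g y))}.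
Proof. by move=> cf cg; exact: cvg_pair. Qed.

Lemma hausdorff_prod :
  hausdorff_space T -> hausdorff_space S -> hausdorff_space (T * S)%type.
Proof.
move=> hT hS p q pq.
have E1 : p.1 = q.1.
  apply: hT => U V pU qV.
  have [z [Uz Vz]] := pq (fst @^-1` U) (fst @^-1` V) (fst_continuous pU)
    (fst_continuous qV).
  by exists z.1.
have E2 : p.2 = q.2.
  apply: hS => U V pU qV.
  have [z [Uz Vz]] := pq (snd @^-1` U) (snd @^-1` V) (snd_continuous pU)
    (snd_continuous qV).
  by exists z.2.
by rewrite [p]surjective_pairing [q]surjective_pairing E1 E2.
Qed.

Lemma second_countable_prod :
  @second_countable T -> @second_countable S ->
  @second_countable (T * S)%type.
Proof.
move=> [B cB [oB bB]] [C cC [oC bC]].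
exists [set X.1 `*` X.2 | X in B `*` C].
  exact: card_le_trans (card_image_le _ _) (countableX cB cC).
split=> [_ [[U V] [/= BU CV] <-]|p D].
  by apply: open_setX; [exact: oB|exact: oC].
move=> [[U V] [/= pU pV] UVD].
have [U' [BU' pU'] U'U] := bB p.1 U pU.
have [V' [CV' pV'] V'V] := bC p.2 V pV.
exists (U' `*` V'); first by split=> //; exists (U', V').
by move=> z [/U'U Uz /V'V Vz]; exact: UVD.
Qed.

End ProductTopology.

(** * Concatenation of row vectors *)
Section RowBlocks.
Context {R : realType} {n m : nat}.

Definition row_inl (u : 'rV[R]_n) : 'rV[R]_(n + m) := row_mx u 0.
Definition row_inr (v : 'rV[R]_m) : 'rV[R]_(n + m) := row_mx 0 v.

Lemma row_inl_linear : linear row_inl.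
Proof.
by move=> a u v; rewrite /row_inl scale_row_mx add_row_mx scaler0 addr0.
Qed.

Lemma row_inr_linear : linear row_inr.
Proof.
by move=> a u v; rewrite /row_inr scale_row_mx add_row_mx scaler0 addr0.
Qed.

HB.instance Definition _ :=
  GRing.isLinear.Build R 'rV[R]_n 'rV[R]_(n + m) _ row_inl row_inl_linear.
HB.instance Definition _ :=
  GRing.isLinear.Build R 'rV[R]_m 'rV[R]_(n + m) _ row_inr row_inr_linear.

Lemma row_mxE (u : 'rV[R]_n) (v : 'rV[R]_m) :
  row_mx u v = row_inl u + row_inr v.
Proof. by rewrite add_row_mx addr0 add0r. Qed.

Lemma row_mx_continuous_at {X : topologicalType} (f : X -> 'rV[R]_n)
    (g : X -> 'rV[R]_m) x :
  {for x, continuous f} -> {for x, continuous g} ->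
  {for x, continuous (fun y => row_mx (f y) (g y))}.
Proof.
move=> cf cg.
have -> : (fun y => row_mx (f y) (g y)) = (row_inl \o f) + (row_inr \o g).
  by apply/funext => y; rewrite row_mxE.
by apply: continuousD; apply: continuous_comp => //;
  exact: linear_rV_continuous.
Qed.

Lemma Ck_on_row_mx {l} k (U : set 'rV[R]_l) (f : 'rV[R]_l -> 'rV[R]_n)
    (g : 'rV[R]_l -> 'rV[R]_m) :
  open U -> Ck_on k U f -> Ck_on k U g ->
  Ck_on k U (fun x => row_mx (f x) (g x)).
Proof.
move=> oU fC gC.
have -> : (fun x => row_mx (f x) (g x)) =
    (fun x => row_inl (f x) + row_inr (g x)).
  by apply/funext => x; rewrite row_mxE.
by apply: Ck_onD => //; apply: Ck_on_linear_comp => //;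
  exact: linear_rV_continuous.
Qed.

End RowBlocks.

(** * Charts *)
Section Charts.
Context {R : realType}.

Lemma chart_image_open {T : topologicalType} {n} (c : chart R T n) (O : set T) :
  is_chart c -> open O -> open (c @` (cdom c `&` O)).
Proof.
move=> hc oO; rewrite openE => _ [p [cp Op] <-].
have cpi : cimg c (c p) by exists p.
have nc : nbhs (c p) (cimg c).
  by apply: open_nbhs_nbhs; split=> //; exact: chart_img_open.
have nO : nbhs (c p) (cinv c @^-1` O).
  apply: (chart_inv_cont hc cpi).
  by rewrite (chart_cancel hc) ?inE //; exact: open_nbhs_nbhs.
near=> x; have [q cq qx] : cimg c x by near: x.
exists q => //; split=> //.
have : (cinv c @^-1` O) x by near: x.
by rewrite /= -qx (chart_cancel hc) ?inE.
Unshelve. all: by end_near. Qed.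

Lemma is_chart_prod {T S : topologicalType} {n m} (c : chart R T n)
    (d : chart R S m) :
  is_chart c -> is_chart d -> is_chart (prod_chart c d).
Proof.
move=> hc hd.
have imgE : cimg (prod_chart c d) = lsubmx @^-1` cimg c `&` rsubmx @^-1` cimg d.
  apply/seteqP; split=> [_ [[p q] [/= cp dq] <-]|z [/= [p cp pz] [q dq qz]]].
    by rewrite /= row_mxKl row_mxKr; split; [exists p|exists q].
  by exists (p, q) => //=; rewrite pz qz hsubmxK.
split.
- by apply: open_setX; exact: chart_dom_open.
- rewrite imgE; apply: openI.
    apply: open_comp; last exact: chart_img_open.
    by move=> z _; exact: continuous_lsubmx.
  apply: open_comp; last exact: chart_img_open.
  by move=> z _; exact: continuous_rsubmx.
- move=> [p q]; rewrite inE => -[/= cp dq].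
  by rewrite /= row_mxKl row_mxKr !(chart_cancel hc, chart_cancel hd) ?inE.
- move=> p [/= cp dp]; apply: row_mx_continuous_at.
    apply: (@continuous_comp _ _ _ fst c p); first exact: fst_continuous.
    exact: chart_cont.
  apply: (@continuous_comp _ _ _ snd d p); first exact: snd_continuous.
  exact: chart_cont.
- rewrite imgE => z [/= cz dz]; apply: pair_continuous_at.
    apply: continuous_comp; first exact: continuous_lsubmx.
    exact: chart_inv_cont.
  apply: continuous_comp; first exact: continuous_rsubmx.
  exact: chart_inv_cont.
Qed.

End Charts.

(** * Smooth maps and product manifolds *)
Section SmoothMaps.
Context {R : realType}.
Implicit Types T S P : topologicalType.

Lemma smooth_map_id {T n} (A : set (chart R T n)) : manifold A -> smooth_map A A id.
Proof.
by move=> hA; split=> [x|c d Ac Ad k]; [exact: cvg_id|exact: (mfd_compat hA Ac Ad k)].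
Qed.

(** Near each point the coordinate expression of [g o f] factors through any
    chart of the middle manifold around the image of that point. *)
Lemma smooth_map_comp {T S P n m l} (A : set (chart R T n))
    (B : set (chart R S m)) (C : set (chart R P l)) (f : T -> S) (g : S -> P) :
  manifold A -> manifold B -> manifold C ->
  smooth_map A B f -> smooth_map B C g -> smooth_map A C (g \o f).
Proof.
move=> hA hB hC [cf fC] [cg gC].
split=> [x|c d Ac Cd k]; first by apply: continuous_comp; [exact: cf|exact: cg].
apply: Ck_on_pointwise => _ [p [cp dp] <-].
have [b Bb bp] := mfd_cover hB (f p).
pose O := f @^-1` (cdom b `&` g @^-1` cdom d).
have oO : open O.
  apply: open_comp => [x _|]; first exact: cf.
  apply: openI; first exact: chart_dom_open (mfd_chart hB Bb).
  by apply: open_comp => [x _|]; [exact: cg|exact: chart_dom_open (mfd_chart hC Cd)].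
have hc := mfd_chart hA Ac.
have oU := chart_image_open hc oO.
exists (c @` (cdom c `&` O)); first by exists p.
pose h := (d \o g \o cinv b) \o (b \o f \o cinv c).
apply: (@Ck_on_eq _ _ _ _ _ h) => //.
  move=> _ /set_mem[q [cq [bq dq]] <-]; rewrite /h /= (chart_cancel hc) ?inE //.
  by rewrite (chart_cancel (mfd_chart hB Bb)) ?inE.
apply: Ck_on_comp (gC b d Bb Cd k) => //.
  move=> _ [q [cq [bq dq]] <-] /=; exists (f q) => //.
  by rewrite (chart_cancel hc) ?inE.
apply: Ck_on_subset (fC c b Ac Bb k) => _ [q [cq [bq dq]] <-].
by exists q.
Qed.

(** The source is any family of charts, so that the lemma can itself prove the
    smoothness of the transition maps of a product atlas. *)
Lemma smooth_map_pair {T S P n m l} (A : set (chart R T n))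
    (B : set (chart R S m)) (C : set (chart R P l)) (f : T -> S) (g : T -> P) :
  (forall c, A c -> is_chart c) -> manifold B -> manifold C ->
  smooth_map A B f -> smooth_map A C g ->
  smooth_map A (prod_atlas B C) (fun x => (f x, g x)).
Proof.
move=> hA hB hC [cf fC] [cg gC].
split=> [x|c _ Ac [b Bb [d Cd <-]] k].
  by apply: pair_continuous_at; [exact: cf|exact: cg].
have oU : open (c @` (cdom c `&` (f @^-1` cdom b `&` g @^-1` cdom d))).
  apply: chart_image_open; first exact: hA.
  apply: openI; apply: open_comp.
  - by move=> x _; exact: cf.
  - exact: chart_dom_open (mfd_chart hB Bb).
  - by move=> x _; exact: cg.
  - exact: chart_dom_open (mfd_chart hC Cd).
apply: Ck_on_row_mx => //.
  apply: Ck_on_subset (fC c b Ac Bb k) => _ [q [cq [bq dq]] <-].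
  by exists q.
apply: Ck_on_subset (gC c d Ac Cd k) => _ [q [cq [bq dq]] <-].
by exists q.
Qed.

Lemma smooth_map_fst {T S n m} (A : set (chart R T n)) (B : set (chart R S m)) :
  manifold A -> manifold B -> smooth_map (prod_atlas A B) A fst.
Proof.
move=> hA hB; split=> [|_ d [c Ac [b Bb <-]] Ad k]; first exact: fst_continuous.
have hc := mfd_chart hA Ac; have hb := mfd_chart hB Bb.
apply: (Ck_on_comp _ _ _ (mfd_compat hA Ac Ad k)); first 1 last.
- move=> _ [q [[cq bq] dq] <-]; exists q.1 => //.
  by rewrite /= row_mxKl.
- exact: (Ck_on_linear _ _ (lsubmx : {linear 'rV[R]_(n + m) -> 'rV[R]_n})).
apply: chart_image_open; first exact: is_chart_prod.
apply: open_comp; last exact: chart_dom_open (mfd_chart hA Ad).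
by move=> x _; exact: fst_continuous.
Qed.

Lemma smooth_map_snd {T S n m} (A : set (chart R T n)) (B : set (chart R S m)) :
  manifold A -> manifold B -> smooth_map (prod_atlas A B) B snd.
Proof.
move=> hA hB; split=> [|_ d [c Ac [b Bb <-]] Bd k]; first exact: snd_continuous.
have hc := mfd_chart hA Ac; have hb := mfd_chart hB Bb.
apply: (Ck_on_comp _ _ _ (mfd_compat hB Bb Bd k)); first 1 last.
- move=> _ [q [[cq bq] dq] <-]; exists q.2 => //.
  by rewrite /= row_mxKr.
- exact: (Ck_on_linear _ _ (rsubmx : {linear 'rV[R]_(n + m) -> 'rV[R]_m})).
apply: chart_image_open; first exact: is_chart_prod.
apply: open_comp; last exact: chart_dom_open (mfd_chart hB Bd).
by move=> x _; exact: snd_continuous.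
Qed.

Lemma manifold_prod {T S n m} (A : set (chart R T n)) (B : set (chart R S m)) :
  manifold A -> manifold B -> manifold (prod_atlas A B).
Proof.
move=> hA hB.
have hch c : prod_atlas A B c -> is_chart c.
  move=> [a Aa [b Bb <-]]; apply: is_chart_prod.
    exact: mfd_chart Aa.
  exact: mfd_chart Bb.
split=> //.
- exact: hausdorff_prod (mfd_hausdorff hA) (mfd_hausdorff hB).
- exact: second_countable_prod (mfd_second_countable hA)
    (mfd_second_countable hB).
- move=> p; have [a Aa ap] := mfd_cover hA p.1; have [b Bb bp] := mfd_cover hB p.2.
  by exists (prod_chart a b) => //; exists a => //; exists b.
(* the transition maps of the product are the coordinate expressions of the
   identity, viewed as the pair of the two projections *)
have [_ sm] := smooth_map_pair hch hA hB (smooth_map_fst hA hB)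
  (smooth_map_snd hA hB).
move=> c d Ac Ad k; move: (sm c d Ac Ad k).
have -> : (fun x : T * S => (x.1, x.2)) = id by apply/funext => -[].
exact.
Qed.

End SmoothMaps.

(** * Transport of separation and countability *)
Section Homeomorphisms.
Context {T S : topologicalType} (f : T -> S) (g : S -> T).
Hypotheses (cf : continuous f) (cg : continuous g) (fK : cancel f g).

Lemma hausdorff_cancel : hausdorff_space S -> hausdorff_space T.
Proof.
move=> hS p q pq; apply: (can_inj fK); apply: hS => U V pU qV.
have [z [Uz Vz]] := pq (f @^-1` U) (f @^-1` V) (cf pU) (cf qV).
by exists (f z).
Qed.

Lemma second_countable_cancel : @second_countable S -> @second_countable T.
Proof.
move=> [B cB [oB bB]]; exists [set f @^-1` U | U in B].
  exact: card_le_trans (card_image_le _ _) cB.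
split=> [_ [U BU <-]|p D pD].
  by apply: open_comp => [x _|]; [exact: cf|exact: oB].
have gD : nbhs (f p) (g @^-1` D) by apply: cg; rewrite fK.
have [U [BU Up] UD] := bB (f p) (g @^-1` D) gD.
exists (f @^-1` U); first by split=> //; exists U.
by move=> z /= /UD /=; rewrite fK.
Qed.

End Homeomorphisms.

(** The balls of radius [1 / (k + 1)] around the rational vectors form a
    countable basis. *)
Lemma second_countable_rV {R : realType} {n} : @second_countable 'rV[R]_n.
Proof.
pose rad k : R := k.+1%:R^-1.
have rad0 k : 0 < rad k by rewrite invr_gt0.
pose b (qk : 'rV[rat]_n * nat) : set 'rV[R]_n :=
  ball (map_mx ratr qk.1 : 'rV[R]_n) (rad qk.2).
exists (range b); first exact: card_le_trans (card_image_le _ _) (countableP _).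
split=> [_ [qk _ <-]|x D]; first exact: ball_open.
move=> /nbhs_ballP[e /= e0 eD].
have e20 : 0 < e / 2 by rewrite divr_gt0.
have [k ke] := @ltr_add_invr R 0 (e / 2) e20; rewrite add0r in ke.
have near_rat i : exists r : rat, ball (x 0 i) (rad k) (ratr r : R).
  have [||z [xq [r _ rq]]] := @dense_rat R (ball (x 0 i) (rad k)).
  - by exists (x 0 i); exact: ballxx.
  - exact: ball_open.
  - by exists r; rewrite rq.
pose q i := sval (cid (near_rat i)).
have hq i : ball (x 0 i) (rad k) (ratr (q i) : R) := svalP (cid (near_rat i)).
have xq : ball (map_mx ratr (\row_i q i) : 'rV[R]_n) (rad k) x.
  by apply: ball_sym; split=> // i j; rewrite !mxE ord1; exact: hq.
exists (b (\row_i q i, k)); first by split=> //; exists (\row_i q i, k).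
move=> y yb; apply: eD; rewrite [e]splitr.
apply: (@ball_triangle _ _ (map_mx ratr (\row_i q i) : 'rV[R]_n)).
  exact: le_ball (ltW ke) _ (ball_sym xq).
exact: le_ball (ltW ke) _ yb.
Qed.

(** * The chain rule in charts *)
Section CoordinateDifferentials.
Context {R : realType}.

Lemma smooth_map_diff {T S : topologicalType} {n m} {A : set (chart R T n)}
    {B : set (chart R S m)} {f : T -> S} {c d} p :
  smooth_map A B f -> A c -> B d -> cdom c p -> cdom d (f p) ->
  differentiable (cmap d \o f \o cinv c) (cmap c p).
Proof. by move=> [_ fC] Ac Bd cp dp; have [+ _] := fC c d Ac Bd 1%N; apply; exists p. Qed.

(** Taking [f] or [g] to be the identity gives the change of chart in the source
    or in the target, and the cocycle identity of the transition maps. *)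
Lemma smooth_map_chain {T S P : topologicalType} {n m l}
    {A : set (chart R T n)} {B : set (chart R S m)} {C : set (chart R P l)}
    {f : T -> S} {g : S -> P} {c d b} p v :
  manifold A -> manifold B -> smooth_map A B f -> smooth_map B C g ->
  A c -> B d -> C b -> cdom c p -> cdom d (f p) -> cdom b (g (f p)) ->
  'd (cmap b \o (g \o f) \o cinv c) (cmap c p) v =
  'd (cmap b \o g \o cinv d) (cmap d (f p))
    ('d (cmap d \o f \o cinv c) (cmap c p) v).
Proof.
move=> hA hB sf sg Ac Bd Cb cp dp bp.
have hc := mfd_chart hA Ac; have hd := mfd_chart hB Bd.
have df := smooth_map_diff sf Ac Bd cp dp.
have dg := smooth_map_diff sg Bd Cb dp bp.
have fE : (cmap d \o f \o cinv c) (cmap c p) = cmap d (f p).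
  by rewrite /= (chart_cancel hc) ?inE.
rewrite -fE in dg *.
have := diff_comp df dg; rewrite funeqE => /(_ v) /= <-.
apply/esym/near_eq_diff; last exact: differentiable_comp.
have oO : open (f @^-1` cdom d).
  by apply: open_comp => [x _|]; [exact: sf.1|exact: chart_dom_open].
have nO : nbhs (cmap c p) (cmap c @` (cdom c `&` f @^-1` cdom d)).
  by apply: open_nbhs_nbhs; split; [exact: chart_image_open|exists p].
near=> x; have [q [cq dq] <-] : (cmap c @` (cdom c `&` f @^-1` cdom d)) x.
  by near: x.
by rewrite /= (chart_cancel hc) ?inE // (chart_cancel hd) ?inE.
Unshelve. all: by end_near. Qed.

End CoordinateDifferentials.

(** * The tangent space as a manifold *)
Lemma charts_at_atlas {R : realType} {T : topologicalType} {n}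
  {A : set (chart R T n)} {p : T} (c : charts_at A p) : A (val c).
Proof. by case: (set_valP c). Qed.

Lemma charts_at_dom {R : realType} {T : topologicalType} {n}
  {A : set (chart R T n)} {p : T} (c : charts_at A p) : cdom (val c) p.
Proof. by case: (set_valP c). Qed.

Section TangentSpace.
Context {R : realType} {T : topologicalType} {n : nat} {A : set (chart R T n)}.
Context (hA : manifold A) (p : T).

Lemma transition_diff_comp (c d b : charts_at A p) v :
  'd (cmap (val b) \o cinv (val c)) (cmap (val c) p) v =
  'd (cmap (val b) \o cinv (val d)) (cmap (val d) p)
    ('d (cmap (val d) \o cinv (val c)) (cmap (val c) p) v).
Proof.
have sid := smooth_map_id hA.
exact: (smooth_map_chain v hA hA sid sid
  (charts_at_atlas c) (charts_at_atlas d) (charts_at_atlas b)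
  (charts_at_dom c) (charts_at_dom d) (charts_at_dom b)).
Qed.

Lemma transition_diff_id (c : charts_at A p) v :
  'd (cmap (val c) \o cinv (val c)) (cmap (val c) p) v = v.
Proof.
have hc := mfd_chart hA (charts_at_atlas c).
have -> : 'd (cmap (val c) \o cinv (val c)) (cmap (val c) p) v =
    'd id (cmap (val c) p) v.
  apply/esym/near_eq_diff => //.
  have : nbhs (cmap (val c) p) (cimg (val c)).
    apply: open_nbhs_nbhs; split; first exact: chart_img_open.
    by exists p => //; exact: charts_at_dom.
  by apply: filterS => _ [q cq <-]; rewrite /= (chart_cancel hc) ?inE.
by rewrite diff_val.
Qed.

Lemma transition_diff_continuous (c d : charts_at A p) :
  continuous ('d (cmap (val d) \o cinv (val c)) (cmap (val c) p)).
Proof.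
apply: diff_continuous.
exact: (smooth_map_diff (smooth_map_id hA)
  (charts_at_atlas c) (charts_at_atlas d) (charts_at_dom c) (charts_at_dom d)).
Qed.

(** By the cocycle identity, the coordinates in one chart extend to a compatible
    family. *)
Lemma tangent_ofP (c : charts_at A p) (x : 'rV[R]_n) :
  (fun d : charts_at A p =>
    'd (cmap (val d) \o cinv (val c)) (cmap (val c) p) x) \in @tangent_pred R T n A p.
Proof. by apply/asboolP => d b; exact: transition_diff_comp. Qed.

Definition tangent_of (c : charts_at A p) (x : 'rV[R]_n) : tangent A p :=
  Tangent (tangent_ofP c x).

Lemma tangent_ofK (c : charts_at A p) :
  cancel (tangent_of c) (fun v : tangent A p => v c).
Proof. by move=> x; exact: transition_diff_id. Qed.

Lemma tcoordK (c : charts_at A p) :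
  cancel (fun v : tangent A p => v c) (tangent_of c).
Proof.
move=> v; apply/val_inj/funext => d.
have /asboolP vP := tangentP v.
by rewrite /= -vP.
Qed.

Lemma tcoord_continuous (c : charts_at A p) :
  continuous (fun v : tangent A p => v c).
Proof.
move=> v U /= vU.
pose f := (@tcoord R T n A p : tangent A p ->
  prod_topology (fun _ : charts_at A p => 'rV[R]_n)).
have cf : {for v, continuous f} by exact: initial_continuous.
suff : nbhs (f v) [set g : charts_at A p -> 'rV[R]_n | U (g c)] by exact: cf.
have /cvg_sup/(_ c) h : nbhs (f v) --> f v by [].
apply: h; exact: (@initial_continuous _ _
  (fun g : charts_at A p -> 'rV[R]_n => g c) (f v) _ vU).
Qed.

(** The topology of the tangent space is initial for the coordinates. *)
Lemma tangent_continuous {X : topologicalType} (f : X -> tangent A p) :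
  (forall c, continuous (fun x => f x c)) -> continuous f.
Proof.
move=> cf; apply: continuous_comp_initial => x.
apply/cvg_sup => c; exact: continuous_comp_initial (cf c) x.
Qed.

Lemma tangent_of_continuous (c : charts_at A p) : continuous (tangent_of c).
Proof. by apply: tangent_continuous => d; exact: transition_diff_continuous. Qed.

Lemma tangent_atlas_coord k : tangent_atlas A p k ->
  exists2 c : charts_at A p,
    cmap k = (fun v => v c) & cinv k = tangent_of c.
Proof.
move=> [_ [c kc] kK Kk]; exists c => //; apply/funext => x.
by apply: (can_inj kK); rewrite Kk kc tangent_ofK.
Qed.

(** The coordinates in one chart are a homeomorphism onto the model space, and
    two such homeomorphisms differ by a linear map. *)
Lemma manifold_tangent : manifold (tangent_atlas A p).
Proof.
have [c0 Ac0 c0p] := mfd_cover hA p.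
have [c _] : exists c : charts_at A p, val c = c0.
  by exists (SigSub (mem_set (conj Ac0 c0p) : c0 \in charts_at A p)).
split.
- apply: hausdorff_cancel (@tcoord_continuous c) (tcoordK c) _.
  exact: norm_hausdorff.
- apply: second_countable_cancel (@tcoord_continuous c)
    (@tangent_of_continuous c) (tcoordK c) _.
  exact: second_countable_rV.
- move=> k Ak; have [d kE iE] := tangent_atlas_coord Ak.
  case: Ak => kT _ kK Kk.
  have imgE : cimg k = setT.
    by apply/seteqP; split=> // x _; exists (cinv k x); rewrite ?kT.
  split; rewrite ?kT ?imgE ?iE ?kE.
  + exact: openT.
  + exact: openT.
  + by move=> v _; rewrite tcoordK.
  + by move=> v _; exact: tcoord_continuous.
  + by move=> x _; exact: tangent_of_continuous.
- move=> v; exists (Chart setT (fun v : tangent A p => v c) (tangent_of c)) => //.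
  by split=> //=; [exists c|exact: tcoordK|exact: tangent_ofK].
- move=> k l /tangent_atlas_coord[c1 kE iE] /tangent_atlas_coord[d lE _] j.
  by rewrite lE iE; exact: Ck_on_linear.
Qed.

End TangentSpace.

(** * Smooth maps into a tangent space *)
Section TangentValued.
Context {R : realType} {T : topologicalType} {n : nat} {A : set (chart R T n)}.
Context (hA : manifold A) (p : T).
Context {X : topologicalType} {m : nat} {B : set (chart R X m)}.
Context (hB : forall c, B c -> is_chart c).
Implicit Types f g : X -> tangent A p.

(** The charts of a tangent space are global and linear, so smoothness of a map
    into it is smoothness of its coordinates, without conditions on domains. *)
Lemma smooth_map_tangentP f :
  smooth_map B (tangent_atlas A p) f <->
  (forall d, continuous (fun x => f x d)) /\
  (forall c (d : charts_at A p), B c ->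
    smooth_on (cimg c) (fun x => f (cinv c x) d)).
Proof.
split=> [[cf fC]|[cf fC]]; split.
- move=> d x; apply: (@continuous_comp _ _ _ f (fun v : tangent A p => v d)).
    exact: cf.
  exact: tcoord_continuous.
- move=> c d Bc k; have Ad : tangent_atlas A p
      (Chart setT (fun v : tangent A p => v d) (tangent_of hA d)).
    by split=> //=; [exists d|exact: tcoordK|exact: tangent_ofK].
  by apply: Ck_on_subset (fC c _ Bc Ad k) => _ [q cq <-]; exists q.
- exact: tangent_continuous.
- move=> c k Bc /(tangent_atlas_coord hA)[d kE _] j; rewrite kE.
  by apply: Ck_on_subset (fC c d Bc j) => _ [q [cq _] <-]; exists q.
Qed.

Lemma smooth_map_tangentD f g :
  smooth_map B (tangent_atlas A p) f -> smooth_map B (tangent_atlas A p) g ->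
  smooth_map B (tangent_atlas A p) (fun x => f x + g x).
Proof.
move=> /smooth_map_tangentP[cf fC] /smooth_map_tangentP[cg gC].
apply/smooth_map_tangentP; split=> [d x|c d Bc k].
  exact: continuousD (cf d x) (cg d x).
apply: Ck_onD (fC c d Bc k) (gC c d Bc k).
exact: chart_img_open (hB Bc).
Qed.

Lemma smooth_map_tangentZ a f :
  smooth_map B (tangent_atlas A p) f ->
  smooth_map B (tangent_atlas A p) (fun x => a *: f x).
Proof.
move=> /smooth_map_tangentP[cf fC].
apply/smooth_map_tangentP; split=> [d x|c d Bc k].
  exact: continuousZl_tmp (cf d x).
apply: (@Ck_on_scale _ _ _ _ _ (cst a)) (fC c d Bc k).
  exact: chart_img_open (hB Bc).
exact: Ck_on_cst.
Qed.

Lemma smooth_map_tangentN f :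
  smooth_map B (tangent_atlas A p) f ->
  smooth_map B (tangent_atlas A p) (fun x => - f x).
Proof.
move=> /(smooth_map_tangentZ (-1)).
by under [X in smooth_map _ _ X]eq_fun do rewrite scaleN1r.
Qed.

End TangentValued.

(** * Tangent maps and immersions *)
Section Immersions.
Context {R : realType} {T S : topologicalType} {n m : nat}.
Context {A : set (chart R T n)} {B : set (chart R S m)}.
Context (hA : manifold A) (hB : manifold B).

(** [tmap] is chosen by its coordinate property, so the content is existence:
    the vector defined by one pair of charts has the required coordinates in
    every other pair, by the chain rule for the changes of chart in the source
    and in the target. *)
Lemma tmapE (f : T -> S) p (v : tangent A p) (c : charts_at A p)
    (d : charts_at B (f p)) :
  smooth_map A B f ->
  tmap B f (f p) v d =
  'd (cmap (val d) \o f \o cinv (val c)) (cmap (val c) p) (v c).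
Proof.
move=> sf; have [Ac cp] := (charts_at_atlas c, charts_at_dom c).
have [Bd dp] := (charts_at_atlas d, charts_at_dom d).
pose P := [set w : tangent B (f p) | f p = f p /\
  forall (c : charts_at A p) (d : charts_at B (f p)),
    w d = 'd (cmap (val d) \o f \o cinv (val c)) (cmap (val c) p) (v c)].
suff [w Pw] : P !=set0 by have [_] := xgetPex 0 (ex_intro _ w Pw); exact.
(* c and d serve as the reference charts that define the vector *)
exists (tangent_of hB d
  ('d (cmap (val d) \o f \o cinv (val c)) (cmap (val c) p) (v c))).
split=> // c' d'.
have [Ac' c'p] := (charts_at_atlas c', charts_at_dom c').
have [Bd' d'p] := (charts_at_atlas d', charts_at_dom d').
have [sA sB] := (smooth_map_id hA, smooth_map_id hB).
have /asboolP/(_ c' c) -> := tangentP v.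
have E1 := smooth_map_chain (v c') hA hA sA sf Ac' Ac Bd c'p cp dp.
have E2 := smooth_map_chain (v c') hA hB sf sB Ac' Bd Bd' c'p dp d'p.
exact: (etrans (congr1 (fun x => tangent_of hB d x d') (esym E1)) (esym E2)).
Qed.

(** Differentiating [g (f x) = x] gives a left inverse of the tangent map. *)
Lemma section_immersion (f : T -> S) (g : S -> T) :
  smooth_map A B f -> smooth_map B A g -> cancel f g -> immersion A B f.
Proof.
move=> sf sg fK; split=> // p v w vw.
apply/val_inj/funext => c; have [Ac cp] := (charts_at_atlas c, charts_at_dom c).
have [d0 Bd0 d0p] := mfd_cover hB (f p).
have [d _] : exists d : charts_at B (f p), val d = d0.
  by exists (SigSub (mem_set (conj Bd0 d0p) : d0 \in charts_at B (f p))).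
have [Bd dp] := (charts_at_atlas d, charts_at_dom d).
have gfp : cdom (val c) (g (f p)) by rewrite fK.
have E (u : tangent A p) : u c =
    'd (cmap (val c) \o g \o cinv (val d)) (cmap (val d) (f p))
      (tmap B f (f p) u d).
  rewrite (tmapE u c d sf).
  rewrite -(smooth_map_chain (u c) hA hB sf sg Ac Bd Ac cp dp gfp).
  have -> : g \o f = id by apply/funext => x; exact: fK.
  exact/esym/(transition_diff_id hA c).
by rewrite /= (E v) (E w) vw.
Qed.

End Immersions.

(** * The group structure on the tangent bundle *)
Section StarGroup.
Context {R : realType} {G : topologicalType} {n : nat}.
Context {A : set (chart R G n)} {mul : G -> G -> G} {e : G} {inv : G -> G}.
Context (nu_u : G -> tangent A e) (lambda : R).
Hypotheses (mulG : group_laws mul e inv) (nu1 : nu_u e = 0)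
  (nuV : forall g, nu_u (inv g) = - nu_u g).

Local Notation s := (sliding_var lambda nu_u).
Local Notation star := (star mul lambda nu_u).
Local Notation TG := (G * tangent A e)%type.

(** The terms in [nu_u] of the operation are a coboundary, which [s] cancels:
    [s] is a homomorphism to the additive group. *)
Lemma sliding_varM (h k : TG) : s (star h k) = s h + s k.
Proof. by rewrite /sliding_var /= subrK addrACA !addrA. Qed.

Lemma sliding_var1 : s (star_one A e) = 0.
Proof. by rewrite /sliding_var /= nu1 scaler0 addr0. Qed.

Lemma sliding_varV (h : TG) : s (star_inv inv h) = - s h.
Proof. by rewrite /sliding_var /= nuV scalerN opprD. Qed.

(** Injectivity of the shear, through which all equations in the tangent bundle
    are checked below. *)
Lemma sliding_var_inj (h k : TG) : h.1 = k.1 -> s h = s k -> h = k.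
Proof.
case: h k => [g v] [g' w] /= <-; rewrite /sliding_var /= => vw.
by rewrite (addIr _ vw).
Qed.

Lemma star_group_laws : group_laws star (star_one A e) (star_inv inv).
Proof.
case: mulG => mA m1 m1' mV mV'.
split=> [h k l|h|h|h|h]; apply: sliding_var_inj;
  rewrite /= ?mA ?m1 ?m1' ?mV ?mV' // !sliding_varM.
- exact: addrA.
- by rewrite sliding_var1 add0r.
- by rewrite sliding_var1 addr0.
- by rewrite sliding_varV addNr sliding_var1.
- by rewrite sliding_varV addrN sliding_var1.
Qed.

Lemma sliding_set_subgroup :
  subgroup_set star (star_one A e) (star_inv inv) (sliding_set lambda nu_u).
Proof.
split=> [|h k hs ks|h hs]; rewrite /sliding_set /= ?sliding_var1 //.
  by rewrite sliding_varM hs ks addr0.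
by rewrite sliding_varV hs oppr0.
Qed.

Definition sliding_section (g : G) : TG := (g, - (lambda *: nu_u g)).

Lemma sliding_var_section g : s (sliding_section g) = 0.
Proof. by rewrite /sliding_var /= addNr. Qed.

Lemma range_sliding_section : range sliding_section = sliding_set lambda nu_u.
Proof.
apply/seteqP; split=> [_ [g _ <-]|h hs]; first exact: sliding_var_section.
by exists h.1 => //; apply: sliding_var_inj; rewrite // sliding_var_section.
Qed.

Lemma sliding_sectionM : {morph sliding_section : g h / mul g h >-> star g h}.
Proof.
move=> g h; apply: sliding_var_inj => //.
by rewrite sliding_varM !sliding_var_section addr0.
Qed.

End StarGroup.

(** * Smoothness of the operations *)
Section StarLieGroup.
Context {R : realType} {G : topologicalType} {n : nat}.
Context {A : set (chart R G n)} {mul : G -> G -> G} {e : G} {inv : G -> G}.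
Context (nu_u : G -> tangent A e) (lambda : R).
Hypotheses (GL : lie_group A mul e inv) (nuS : smooth_map A (tangent_atlas A e) nu_u).

Let hA : manifold A := lie_manifold GL.
Let hT : manifold (tangent_atlas A e) := manifold_tangent hA e.
Let hTG : manifold (TG_atlas A e) := manifold_prod hA hT.

Lemma star_smooth :
  smooth_map (prod_atlas (TG_atlas A e) (TG_atlas A e)) (TG_atlas A e)
    (fun x => star mul lambda nu_u x.1 x.2).
Proof.
set B := prod_atlas _ _; have hB : manifold B := manifold_prod hTG hTG.
have chB := @mfd_chart _ _ _ _ hB.
have s1 : smooth_map B (TG_atlas A e) fst := smooth_map_fst hTG hTG.
have s2 : smooth_map B (TG_atlas A e) snd := smooth_map_snd hTG hTG.
have g1 := smooth_map_comp hB hTG hA s1 (smooth_map_fst hA hT).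
have g2 := smooth_map_comp hB hTG hA s2 (smooth_map_fst hA hT).
have v1 := smooth_map_comp hB hTG hT s1 (smooth_map_snd hA hT).
have v2 := smooth_map_comp hB hTG hT s2 (smooth_map_snd hA hT).
have g12 := smooth_map_comp hB (manifold_prod hA hA) hA
  (smooth_map_pair chB hA hA g1 g2) (lie_mul_smooth GL).
have k g (sg : smooth_map B A g) :
    smooth_map B (tangent_atlas A e) (fun x => lambda *: nu_u (g x)).
  exact: (smooth_map_tangentZ hA chB lambda (smooth_map_comp hB hA hT sg nuS)).
have D := smooth_map_tangentD hA chB.
have nuD := D _ _ _ (D _ _ _ (D _ _ _ (D _ _ _ v1 v2) (k _ g1)) (k _ g2))
  (smooth_map_tangentN hA chB (k _ g12)).
exact: (smooth_map_pair chB hA hT g12 nuD).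
Qed.

Lemma star_inv_smooth :
  smooth_map (TG_atlas A e) (TG_atlas A e) (star_inv inv).
Proof.
have chTG := @mfd_chart _ _ _ _ hTG.
have sg := smooth_map_comp hTG hA hA (smooth_map_fst hA hT) (lie_inv_smooth GL).
exact: (smooth_map_pair chTG hA hT sg
  (smooth_map_tangentN hA chTG (smooth_map_snd hA hT))).
Qed.

Lemma sliding_section_immersion :
  immersion A (TG_atlas A e) (sliding_section nu_u lambda).
Proof.
have chA := @mfd_chart _ _ _ _ hA.
apply: (section_immersion hA hTG (g := fst)).
- apply: (smooth_map_pair chA hA hT (smooth_map_id hA)).
  exact: (smooth_map_tangentN hA chA (smooth_map_tangentZ hA chA lambda nuS)).
- exact: smooth_map_fst.
- by [].
Qed.

End StarLieGroup.

(** * The sliding subgroup *)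

Theorem lemma4 (R : realType) (G : topologicalType) (n : nat)
    (A : set (chart R G n)) (mul : G -> G -> G) (e : G) (inv : G -> G)
    (V : G -> R) (nu_u : G -> tangent A e) (lambda : R) :
  lie_group A mul e inv ->
  potential A e V ->
  kinematic_control_law mul inv V nu_u ->
  smooth_map A (tangent_atlas A e) nu_u ->
  0 < lambda ->
  lie_subgroup (TG_atlas A e) (star mul lambda nu_u) (star_one A e)
    (star_inv inv) (sliding_set lambda nu_u).
Proof.
move=> GL _ [nu1 nuV _ _] nuS _; have hA := lie_manifold GL.
have mulG := lie_group_laws GL; split.
- split.
  + exact: manifold_prod hA (manifold_tangent hA e).
  + exact: star_group_laws.
  + exact: star_smooth GL nuS.
  + exact: star_inv_smooth GL.
- exact: sliding_set_subgroup.
(* the abstract Lie group is G itself, embedded by the section *)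
- exists G, n, A, mul, e, inv, (sliding_section nu_u lambda); split.
  + exact: GL.
  + exact: sliding_section_immersion GL nuS.
  + by move=> g h [].
  + exact: range_sliding_section.
  + exact: sliding_sectionM.
Qed.
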